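(* Let $\mathcal{P}$ be the KL uncertainty set with nominal kernel $\bar P$ and radii $\beta_{sa}>0$, and let $\pi$ be a stationary policy. Let $(P_n)_{n\ge0}$ be a sequence of transition kernels with $P_0=\bar P$ and, for all $n\ge0$ and all $s,s'\in\mathcal{S}$, $a\in\mathcal{A}$, $$P_{n+1}(s'|s,a)=\bar P(s'|s,a)\,\exp\Bigl(-\frac{v^\pi_{P_n}(s')-\omega_{n,sa}}{\kappa_{n,sa}}\Bigr),$$ where $\omega_{n,sa}\in\mathbb{R}$ and $\kappa_{n,sa}>0$ are the constants associated with the target function $v^\pi_{P_n}$, i.e. they satisfy $$\sum_{s'\in\mathcal{S}}P_{n+1}(s'|s,a)=1,\qquad -\sum_{s'\in\mathcal{S}}P_{n+1}(s'|s,a)\,\frac{v^\pi_{P_n}(s')-\omega_{n,sa}}{\kappa_{n,sa}}=\beta_{sa}.$$ Then for every $n\ge0$, $$\|v^\pi_{P_n}-v^\pi_{\mathcal{P}}\|_\infty\le\gamma^n\,\|v^\pi_{\bar P}-v^\pi_{\mathcal{P}}\|_\infty.$$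
   Context: An MDP is $(\mathcal{S},\mathcal{A},P,R,\gamma,\mu)$ with finite state space $\mathcal{S}$ and finite action space $\mathcal{A}$, transition kernel $P:\mathcal{S}\times\mathcal{A}\to\Delta_{\mathcal{S}}$ ($\Delta_{\mathcal{S}}$ is the probability simplex over $\mathcal{S}$), reward $R:\mathcal{S}\times\mathcal{A}\to\mathbb{R}$, discount $\gamma\in[0,1)$, and initial distribution $\mu\in\Delta_{\mathcal{S}}$. A stationary policy is a map $\pi:\mathcal{S}\to\Delta_{\mathcal{A}}$. For a kernel $P$, $v^\pi_P(s)=\mathbb{E}_{\pi,P}[\sum_{t\ge0}\gamma^tR(s_t,a_t)\mid s_0=s]$ is the (non-robust) value function. KL uncertainty set: given a nominal kernel $\bar P$ and radii $\beta_{sa}>0$, $\mathcal{P}$ is the set of kernels $P$ with $P(\cdot|s,a)\in\mathcal{P}_{sa}=\{p\in\Delta_{\mathcal{S}} : D_{\mathrm{KL}}(p\,\|\,\bar P(\cdot|s,a))\le\beta_{sa}\}$ for every $(s,a)$, where $D_{\mathrm{KL}}(p\|q)=\sum_sp(s)\log(p(s)/q(s))$, with $0\log 0=0$ and value $+\infty$ if $p(s)>0=q(s)$ for some $s$. Robust value function: $v^\pi_{\mathcal{P}}=\min_{P\in\mathcal{P}}v^\pi_P$ (minimum taken componentwise; well defined for such $\mathcal{P}$). *)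

(* Defs.v *)
From HB Require Import structures.
From mathcomp Require Import all_boot all_order all_algebra.
From mathcomp Require Import all_classical all_reals all_analysis.
Set Implicit Arguments.
Unset Strict Implicit.
Unset Printing Implicit Defensive.
Import Order.TTheory GRing.Theory Num.Theory.
Import numFieldNormedType.Exports.
Local Open Scope classical_set_scope.
Local Open Scope ring_scope.

Definition simplex (R : realType) (T : finType) : set (T -> R) :=
  [set p | (forall x, 0 <= p x) /\ \sum_x p x = 1].

(* P s a s' stands for P(s'|s,a), and pi s a for pi(a|s). *)
Definition kernels (R : realType) (S A : finType) : set (S -> A -> S -> R) :=
  [set P | forall s a, simplex (P s a)].

Definition policies (R : realType) (S A : finType) : set (S -> A -> R) :=
  [set pi | forall s, simplex (pi s)].

(* Under Pr, the process (X_t, U_t) is the state-action process of the policy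
   pi and the kernel P started at X_0 = s.  It is specified by its
   finite-dimensional laws. *)
Definition controlled_chain (R : realType) (S A : finType)
    (pi : S -> A -> R) (P : S -> A -> S -> R) (s : S)
    (d : measure_display) (Omega : measurableType d) (Pr : probability Omega R)
    (X : nat -> Omega -> S) (U : nat -> Omega -> A) : Prop :=
  [/\ forall t x, measurable (X t @^-1` [set x]),
      forall t a, measurable (U t @^-1` [set a]) &
      forall (n : nat) (x : nat -> S) (a : nat -> A),
        Pr [set w | forall t, (t <= n)%N -> X t w = x t /\ U t w = a t] =
        ((x 0%N == s)%:R * \prod_(t < n.+1) pi (x t) (a t) *
         \prod_(t < n) P (x t) (a t) (x t.+1))%:E].

Definition discounted_return (R : realType) (S A : finType)
    (r : S -> A -> R) (gamma : R) (x : nat -> S) (a : nat -> A) : R :=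
  limn (series (fun t => gamma ^+ t * r (x t) (a t))).

(* The expectation depends only on the law of the process, so all realizations
   of the chain give the same number. *)
Definition is_value (R : realType) (S A : finType) (r : S -> A -> R) (gamma : R)
    (pi : S -> A -> R) (P : S -> A -> S -> R) (s : S) (v : R) : Prop :=
  exists (d : measure_display) (Omega : measurableType d)
         (Pr : probability Omega R)
         (X : nat -> Omega -> S) (U : nat -> Omega -> A),
    controlled_chain pi P s Pr X U /\
    expectation Pr (fun w => discounted_return r gamma (X^~ w) (U^~ w)) = v%:E.

Definition value (R : realType) (S A : finType) (r : S -> A -> R) (gamma : R)
    (pi : S -> A -> R) (P : S -> A -> S -> R) (s : S) : R :=
  xget 0 [set v | is_value r gamma pi P s v].

Definition kl_term (R : realType) (x y : R) : \bar R :=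
  if x == 0 then 0%E else if y == 0 then +oo%E else (x * ln (x / y))%:E.

Definition kl (R : realType) (T : finType) (p q : T -> R) : \bar R :=
  (\sum_x kl_term (p x) (q x))%E.

Definition kl_uncertainty (R : realType) (S A : finType)
    (Pbar : S -> A -> S -> R) (beta : S -> A -> R) : set (S -> A -> S -> R) :=
  [set P | kernels P /\
           forall s a, (kl (P s a) (Pbar s a) <= (beta s a)%:E)%E].

(* Least element of E (0 if there is none). *)
Definition minimum (R : realType) (E : set R) : R := xget 0 (E `&` lbound E).

Definition robust_value (R : realType) (S A : finType) (r : S -> A -> R)
    (gamma : R) (pi : S -> A -> R) (U : set (S -> A -> S -> R)) (s : S) : R :=
  minimum [set value r gamma pi P s | P in U].

Definition supnorm (R : realType) (T : finType) (f : T -> R) : R :=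
  \big[Num.max/0]_x `|f x|.

(* Main.v *)
Require Import Defs.
From HB Require Import structures.
From mathcomp Require Import all_boot all_order all_algebra.
From mathcomp Require Import all_classical all_reals all_analysis.
From mathcomp Require Import measurable_realfun ring lra.
Set Implicit Arguments.
Unset Strict Implicit.
Unset Printing Implicit Defensive.
Import Order.TTheory GRing.Theory Num.Theory.
Import numFieldNormedType.Exports.
Local Open Scope classical_set_scope.
Local Open Scope ring_scope.

(* Each v_P is the unique fixed point of the Bellman operator B_P; existence of
   the state-action chain is obtained by splitting [0, 1) with Lebesgue measure.
   By Gibbs' inequality the tilted kernel P_(n+1) minimizes <p, v_(P_n)> over
   the KL balls, so it is greedy for v_n := v_(P_n).  The KL balls are compact,
   so a kernel Q greedy for inf_P v_P exists, and v_Q attains this infimum.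
   As P_n lies in the uncertainty set, B_(P_(n+1)) v_n <= v_n, hence v_(n+1) <= v_n
   and v_Q <= v_(n+1) <= B_(P_(n+1)) v_n <= B_Q v_n; subtracting
   v_Q = B_Q v_Q gives a contraction by gamma. *)

(** * Realizing a finite Markov chain on the unit interval *)

Section IntervalChain.
Context {R : realType} {Z : finType} (z0 : Z).

(* For u in [0, sum q), the index of the subinterval of length q z containing u,
   and the relative position of u in it: for uniform u, the latter is again
   uniform and independent of the index.  For u >= sum q, [z0] is junk. *)
Fixpoint split_point (s : seq Z) (q : Z -> R) (u : R) : Z * R :=
  if s is z :: s' then
    if u < q z then (z, u / q z) else split_point s' q (u - q z)
  else (z0, u).

Lemma measurable_split_point (s : seq Z) (q : Z -> R) z (B : set R) :
  measurable B -> measurable [set u | (split_point s q u).1 = z /\ B (split_point s q u).2].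
Proof.
move=> mB; elim: s => [|y s IH] /=.
  case: (eqVneq z0 z) => [->|nz].
    by rewrite (_ : [set _ | _] = B)//; apply/seteqP; split=> u //= [].
  rewrite (_ : [set _ | _] = set0)//; apply/seteqP; split=> u //= [] e.
  by rewrite e eqxx in nz.
have mscale : measurable ((fun u : R => u / q y) @^-1` B).
  rewrite -[X in measurable X]setTI.
  have : measurable_fun setT (fun u : R => u / q y) by exact: measurable_funM.
  by apply.
have mshift : measurable ((fun u : R => u - q y) @^-1`
    [set u | (split_point s q u).1 = z /\ B (split_point s q u).2]).
  rewrite -[X in measurable X]setTI.
  have : measurable_fun setT (fun u : R => u - q y) by exact: measurable_funB.
  by apply.
set C := (X in measurable X).
rewrite (_ : C =
  (`]-oo, q y[ `&` ([set _ | y = z] `&` (fun u : R => u / q y) @^-1` B))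
  `|` (`[q y, +oo[ `&` (fun u : R => u - q y) @^-1`
    [set u | (split_point s q u).1 = z /\ B (split_point s q u).2])).
  apply: measurableU; apply: measurableI => //; apply: measurableI => //.
  case: (eqVneq y z) => yz; [rewrite (_ : [set _ | _] = setT)//|rewrite (_ : [set _ | _] = set0)//].
    by apply/seteqP; split.
  by apply/seteqP; split=> // _ /= e; rewrite e eqxx in yz.
rewrite /C; apply/seteqP; split=> u /=; rewrite !in_itv/= andbT.
  by case: ltP => h; [left|right].
by case: ltP => h [[]|[]].
Qed.

Lemma split_point_ge0_lt1 (s : seq Z) (q : Z -> R) u :
  0 <= u < \sum_(z <- s) q z -> 0 <= (split_point s q u).2 < 1.
Proof.
elim: s u => [|y s IH] u /=; first by rewrite big_nil; lra.
rewrite big_cons => /andP[u0 us]; case: ltP => h /=.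
  have q0 : 0 < q y by exact: le_lt_trans h.
  by rewrite divr_ge0 ?(ltW q0)//= ltr_pdivrMr// mul1r.
by apply: IH; rewrite subr_ge0 h/= ltrBlDl.
Qed.

(** Here [c] is the total length of the subintervals listed before [z], and the event is the image
    of [[a, b)] under the affine map from [[0, 1)] onto the subinterval of [z]. The bounds on [c]
    keep nested intervals inside the range. *)
Lemma split_point_interval (s : seq Z) (q : Z -> R) z a b :
  (forall z, 0 <= q z) -> uniq s -> z \in s -> 0 <= a -> b <= 1 ->
  exists2 c, 0 <= c /\ c + q z <= \sum_(z <- s) q z & forall u,
    (0 <= u < \sum_(z <- s) q z /\ (split_point s q u).1 = z /\
     a <= (split_point s q u).2 < b) <-> c + q z * a <= u < c + q z * b.
Proof.
move=> q0; elim: s => [//|y s IH] /= /andP[ys us].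
have s0 : 0 <= \sum_(z <- s) q z by apply: sumr_ge0.
have qy := q0 y; rewrite big_cons inE => zs a0 b1.
have [e|ne] := eqVneq z y; last first.
  move: zs; rewrite (negbTE ne)/= => zs.
  have [c [c0 cz] H] := IH us zs a0 b1.
  exists (q y + c); first by split; [exact: addr_ge0|rewrite -addrA lerD2l].
  move=> u; split.
    case=> /andP[u0 uq] []; case: ltP => h /=; first by move=> yz; rewrite yz eqxx in ne.
    move=> h1 h2; suff : c + q z * a <= u - q y < c + q z * b by lra.
    by apply/H; split; [lra|split].
  move=> hu; have [] := (H (u - q y)).2; first lra.
  move=> h1 [h2 h3]; have h : ~~ (u < q y) by rewrite -leNgt; lra.
  by rewrite (negbTE h); split; [lra|split].
subst y; exists 0; first by rewrite add0r; lra.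
move=> u; rewrite !add0r; split.
  case=> /andP[u0 uq] []; case: ltP => h /=; last first.
    (* A point within the total length of [s] is assigned an element of [s], never the junk index,
       whereas [uniq] excludes [z] from the tail. *)
    move=> e; have : (split_point s q (u - q z)).1 \in s.
      have : u - q z < \sum_(z <- s) q z by lra.
      have : 0 <= u - q z by lra.
      move: (u - q z) => {e h us ys IH zs uq u0 s0}.
      elim: s => [|y s IH] v v0 /=; first by rewrite big_nil; lra.
      rewrite big_cons inE; case: (ltP v (q y)) => h vs /=; first by rewrite eqxx.
      by apply/orP; right; apply: IH; lra.
    by rewrite e (negbTE ys).
  have qz : 0 < q z by exact: le_lt_trans h.
  by move=> _; rewrite ler_pdivlMr// ltr_pdivrMr// ![_ * q z]mulrC.
move=> /andP[h1 h2].
(* With [q z = 0] the half-open interval containing [u] would be empty. *)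
have qz : 0 < q z.
  rewrite lt_neqAle q0 andbT; apply/eqP => e; rewrite -e in h1 h2; lra.
have qb : q z * b <= q z by rewrite ger_pMr.
have uq : u < q z by lra.
have u0 : 0 <= u by apply: le_trans h1; exact: mulr_ge0.
rewrite uq /= ler_pdivlMr// ltr_pdivrMr// ![_ * q z]mulrC h1 h2.
by split => //; lra.
Qed.

Variable K : Z -> Z -> R.

(** The relative position left over by one draw is used as the uniform variable of the next, so a
    single [u] drives the whole trajectory; [q] is the law of the state about to be drawn. *)
Fixpoint unit_chain (q : Z -> R) (n : nat) (u : R) : Z :=
  let zu := split_point (enum Z) q u in
  if n is n'.+1 then unit_chain (K zu.1) n' zu.2 else zu.1.

Lemma measurable_unit_chain q n z :
  measurable [set u | unit_chain q n u = z].
Proof.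
elim: n q => [|n IH] q /=.
  rewrite (_ : [set _ | _] = [set u | (split_point (enum Z) q u).1 = z /\
     [set: R] (split_point (enum Z) q u).2]); first exact: measurable_split_point.
  by apply/seteqP; split=> u //= [].
rewrite (_ : [set _ | _] = \big[setU/set0]_(y : Z)
   [set u | (split_point (enum Z) q u).1 = y /\
     [set u | unit_chain (K y) n u = z] (split_point (enum Z) q u).2]).
  by apply: bigsetU_measurable => y _; exact: measurable_split_point.
apply/seteqP; split=> u /=.
  move=> h; rewrite -bigcup_seq/=; exists (split_point (enum Z) q u).1 => //=.
  by rewrite mem_index_enum.
by rewrite -bigcup_seq => -[y _ /= [<-]].
Qed.

(** Cylinders are intervals: after the first draw, the rest is a chain with initial law [K (x 0)] in
    the rescaled coordinate, and pulling its interval back through the affine map multiplies the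
    length by [q (x 0)]. *)
Lemma unit_chain_interval q n (x : nat -> Z) :
  (forall z, 0 <= q z) -> \sum_z q z = 1 ->
  (forall y z, 0 <= K y z) -> (forall y, \sum_z K y z = 1) ->
  exists a b, [/\ 0 <= a, a <= b, b <= 1,
    b - a = q (x 0%N) * \prod_(t < n) K (x t) (x t.+1) &
    forall u, (0 <= u < 1 /\ forall t, (t <= n)%N -> unit_chain q t u = x t)
      <-> a <= u < b].
Proof.
move=> q0 q1 K0 K1; elim: n q x q0 q1 => [|n IH] q x q0 q1.
  have [c [c0 cq] H] := @split_point_interval (enum Z) q (x 0%N) 0 1 q0 (enum_uniq _)
    (mem_enum _ _) (lexx _) (lexx _).
  move: cq H; rewrite big_enum q1 /= mulr0 mulr1 addr0 => cq H.
  exists c, (c + q (x 0%N)); split => //.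
  - by rewrite lerDl.
  - by rewrite big_ord0; ring.
  - move=> u; split.
      case=> u01 /(_ 0%N isT)/= e; apply/H; split => //; split => //.
      by apply: split_point_ge0_lt1; rewrite big_enum q1.
    by move/H => [h1 [h2 h3]]; split => // -[].
have [a [b [a0 ab b1 len H]]] := IH (K (x 0%N)) (fun t => x t.+1) (K0 _) (K1 _).
have [c [c0 cq] H'] := @split_point_interval (enum Z) q (x 0%N) a b q0 (enum_uniq _)
    (mem_enum _ _) a0 b1.
move: cq H'; rewrite big_enum q1 /= => cq H'.
exists (c + q (x 0%N) * a), (c + q (x 0%N) * b); split.
- by rewrite addr_ge0// mulr_ge0.
- by rewrite lerD2l ler_wpM2l.
- by apply: le_trans cq; rewrite lerD2l ler_piMr.
- by rewrite big_ord_recl /= -len; ring.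
move=> u; split.
  case=> u01 e; apply/H'; split => //.
  have e0 : (split_point (enum Z) q u).1 = x 0%N by exact: (e 0%N).
  split => //; apply/H; split.
    by apply: split_point_ge0_lt1; rewrite big_enum q1.
  by move=> t tn; have := e t.+1 tn; rewrite /= e0.
move=> /H' [u01 [e0 /H [h e]]]; split => // -[|t] tn //=.
by rewrite e0; exact: e.
Qed.

End IntervalChain.

Section UnitInterval.
Context (R : realType).

(** Lebesgue measure stays on the whole line with its mass restricted to [[0, 1)], so that the chain
    may be a function of every real [u]. *)
Definition unit_measure : set _ -> \bar R :=
  mrestr (@lebesgue_measure R) (measurable_itv `[0, 1[).

HB.instance Definition _ := Measure.copy unit_measure
  (mrestr (@lebesgue_measure R) (measurable_itv `[0, 1[)).

Lemma unit_measureT : unit_measure setT = 1%:E.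
Proof.
rewrite /unit_measure /mrestr setTI lebesgue_measure_itv /= lte_fin ltr01.
by rewrite -EFinB subr0.
Qed.

HB.instance Definition _ := Measure_isProbability.Build _ _ R unit_measure unit_measureT.

End UnitInterval.

(** * Bellman equation *)

Lemma cvg_fin_sum {R : realType} {T : Type} {I : finType} (F : set_system T)
    (f : I -> T -> R) (l : I -> R) : Filter F ->
  (forall i, f i x @[x --> F] --> l i) ->
  (\sum_i f i x) @[x --> F] --> \sum_i l i.
Proof.
move=> FF fl.
have := @cvg_big R I +%R 0 xpredT (@add_continuous R) T F (index_enum I) f l FF.
by apply => i _; exact: fl.
Qed.

(** * Expectations along a finite Markov chain *)

Section FiniteChain.
Context {R : realType} {Z : finType} (q : Z -> R) (K : Z -> Z -> R).
Context {d : measure_display} {Omega : measurableType d} (Pr : probability Omega R).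
Variable W : nat -> Omega -> Z.
Hypothesis mW : forall t z, measurable [set w | W t w = z].

Definition cylinder n (z : nat -> Z) : set Omega :=
  [set w | forall t, (t <= n)%N -> W t w = z t].

Hypothesis law : forall n z,
  Pr (cylinder n z) = (q (z 0%N) * \prod_(t < n) K (z t) (z t.+1))%:E.

(** The transition operator of the chain; its [m]-th iterate gives the conditional expectation of
    [g] after [m] steps. *)
Definition expected_next (g : Z -> R) (y : Z) : R := \sum_z K y z * g z.

Lemma measurable_cylinder n z : measurable (cylinder n z).
Proof.
rewrite (_ : cylinder n z = \bigcap_(t in [set t | (t <= n)%N]) [set w | W t w = z t]).
  by apply: bigcap_measurable => //; exists 0%N.
by apply/seteqP; split.
Qed.

Lemma measurable_fun_state t (h : Z -> R) : measurable_fun setT (fun w => h (W t w)).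
Proof.
move=> _ Y mY; rewrite setTI.
rewrite (_ : _ @^-1` Y = \big[setU/set0]_(z | h z \in Y) [set w | W t w = z]).
  exact: bigsetU_measurable.
apply/seteqP; split=> w; rewrite big_mkcond -bigcup_seq/=.
  by move=> hw; exists (W t w); rewrite /= ?mem_index_enum// mem_set.
by move=> [z _]; case: ifPn => // /set_mem hz /= ->.
Qed.

(* The Markov property, by splitting the cylinder along the next state. *)
Lemma integral_state_cylinder (h : Z -> R) m n z :
  (\int[Pr]_(w in cylinder n z) (h (W (n + m) w))%:E =
   (q (z 0%N) * \prod_(t < n) K (z t) (z t.+1) * iter m expected_next h (z n))%:E)%E.
Proof.
elim: m n z => [|m IH] n z.
  rewrite addn0 (eq_integral (cst (h (z n))%:E)).
    rewrite integral_cst; last exact: measurable_cylinder.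
    by rewrite [X in (_ * X)%E](law n z) -EFinM mulrC.
  by move=> w /set_mem /= -> //.
pose ext y t := if t == n.+1 then y else z t.
have extE y t : (t <= n)%N -> ext y t = z t by rewrite /ext; case: eqP => // ->; rewrite ltnn.
have extn y : ext y n.+1 = y by rewrite /ext eqxx.
rewrite (_ : cylinder n z = \big[setU/set0]_(y <- enum Z) cylinder n.+1 (ext y)); last first.
  apply/seteqP; split=> w; rewrite -bigcup_seq/=.
    move=> cw; exists (W n.+1 w); rewrite /= ?mem_enum// => t.
    by rewrite leq_eqVlt => /orP[/eqP ->|]; [rewrite extn|rewrite ltnS => tn; rewrite extE// cw].
  by move=> [y _ cw] t tn; rewrite cw ?extE// ltnW.
rewrite integral_bigsetU_EFin.
- have -> : iter m.+1 expected_next h (z n) =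
    \sum_y K (z n) y * iter m expected_next h y by [].
  rewrite big_enum /= mulr_sumr -sumEFin; apply: eq_bigr => y _.
  rewrite addnS -addSn IH extn big_ord_recr /= extn (extE y 0%N)// (extE y n)// !mulrA.
  congr (_ * _ * _ * _)%:E.
  by apply: eq_bigr => i _; rewrite !extE// ltnW.
- by move=> y; exact: measurable_cylinder.
- exact: enum_uniq.
- move=> y y' _ _ [w [/(_ n.+1 (leqnn _)) + /(_ n.+1 (leqnn _))]].
  by rewrite !extn => -> ->.
- apply: measurable_funTS; apply/measurable_EFinP; exact: measurable_fun_state.
Qed.

Lemma integral_state (h : Z -> R) t :
  (\int[Pr]_w (h (W t w))%:E = (\sum_z q z * iter t expected_next h z)%:E)%E.
Proof.
rewrite (_ : setT = \big[setU/set0]_(y <- enum Z) cylinder 0 (fun=> y)); last first.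
  apply/seteqP; split=> // w _; rewrite -bigcup_seq/=.
  by exists (W 0%N w); rewrite /= ?mem_enum// => -[].
rewrite integral_bigsetU_EFin.
- rewrite big_enum /= -sumEFin; apply: eq_bigr => y _.
  by rewrite -[t]add0n integral_state_cylinder big_ord0 mulr1.
- by move=> y; exact: measurable_cylinder.
- exact: enum_uniq.
- by move=> y y' _ _ [w [/(_ 0%N (leqnn _)) + /(_ 0%N (leqnn _))]] => -> ->.
- apply: measurable_funTS; apply/measurable_EFinP; exact: measurable_fun_state.
Qed.

End FiniteChain.

(** * The value function as a fixed point of the Bellman operator *)

Section Value.
Context {R : realType} {S A : finType} (r : S -> A -> R) (gamma : R).
Variables (pi : S -> A -> R) (P : S -> A -> S -> R).
Hypotheses (hpi : policies pi) (hP : kernels P).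

(** Guarantees that [value] is not the default of [xget]. The state-action pairs form a Markov chain
    with initial law [q] and kernel [K], which the interval construction realizes. *)
Lemma exists_controlled_chain s : exists (d : measure_display) (Omega : measurableType d)
    (Pr : probability Omega R) (X : nat -> Omega -> S) (U : nat -> Omega -> A),
  controlled_chain pi P s Pr X U.
Proof.
(* An action exists because [pi s] has total mass 1; [a0] only fills the junk index of
   [split_point]. *)
have a0 : A.
  have [_ h] := hpi s; case: (pickP (@predT A)) => [a _|h0]; first exact: a.
  by move: h; rewrite big_pred0// => /eqP; rewrite eq_sym oner_eq0.
pose q (z : S * A) : R := (z.1 == s)%:R * pi z.1 z.2.
pose K (y z : S * A) : R := P y.1 y.2 z.1 * pi z.1 z.2.
have sumP (g : S -> R) : \sum_z g z.1 * pi z.1 z.2 = \sum_x g x.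
  rewrite -(pair_bigA _ (fun x a => g x * pi x a)) /=; apply: eq_bigr => x _.
  by rewrite -big_distrr /= (hpi x).2 mulr1.
have q0 z : 0 <= q z by rewrite mulr_ge0// (hpi _).1.
have K0 y z : 0 <= K y z by rewrite mulr_ge0// ?(hpi _).1// (hP _ _).1.
have q1 : \sum_z q z = 1.
  by rewrite (sumP (fun x => (x == s)%:R)) (bigD1 s)//= eqxx big1 ?addr0// => x /negbTE ->.
have K1 y : \sum_z K y z = 1 by rewrite sumP (hP _ _).2.
pose Z n u := unit_chain (s, a0) K q n u.
exists _, _, (@unit_measure R : probability _ _), (fun n u => (Z n u).1), (fun n u => (Z n u).2).
split.
- move=> t x.
  rewrite (_ : _ @^-1` _ = \big[setU/set0]_(a : A) [set u | Z t u = (x, a)]).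
    by apply: bigsetU_measurable => y _; exact: measurable_unit_chain.
  apply/seteqP; split=> u; rewrite -bigcup_seq/=.
    by move=> e; exists (Z t u).2; rewrite /= ?mem_index_enum// -e -surjective_pairing.
  by move=> [y _ /= ->].
- move=> t a.
  rewrite (_ : _ @^-1` _ = \big[setU/set0]_(x : S) [set u | Z t u = (x, a)]).
    by apply: bigsetU_measurable => y _; exact: measurable_unit_chain.
  apply/seteqP; split=> u; rewrite -bigcup_seq/=.
    by move=> e; exists (Z t u).1; rewrite /= ?mem_index_enum// -e -surjective_pairing.
  by move=> [y _ /= ->].
move=> n x a.
have [c [b [c0 cb b1 len H]]] := unit_chain_interval (s, a0) n (fun t => (x t, a t)) q0 q1 K0 K1.
(* Restricting the measure to [[0, 1)] intersects the event with the unit interval, which turns it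
   into the interval found above. *)
transitivity (@lebesgue_measure R `[c, b[%classic); last first.
  rewrite lebesgue_measure_itv /= lte_fin.
  have -> : (if (c < b)%R then b%:E - c%:E else 0)%E = (b - c)%:E.
    case: ltP => // bc; suff -> : b = c by rewrite subrr.
    by apply/eqP; rewrite eq_le cb bc.
  by rewrite len /q /K /= big_split /= big_ord_recl /=; congr (_%:E); ring.
congr (lebesgue_measure _); apply/seteqP; split=> u /=; rewrite !in_itv/=.
  move=> [h u01]; apply/H; split=> // t tn; have [<- <-] := h t tn.
  exact: surjective_pairing.
by move=> /H[u01 e]; split=> // t /e; rewrite /Z => ->.
Qed.

Hypothesis hgamma : 0 <= gamma < 1.

Let step (y z : S * A) : R := P y.1 y.2 z.1 * pi z.1 z.2.

Definition bellman (w : S -> R) (s : S) : R :=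
  \sum_a pi s a * (r s a + gamma * \sum_s' P s a s' * w s').

(** The mean of the reward at time [t] from [s], written with the transition operator so that no
    probability space is involved. *)
Definition expected_reward t s : R :=
  \sum_a pi s a * iter t (expected_next step) (fun z => r z.1 z.2) (s, a).

Definition bellman_value s : R :=
  limn (series (fun t => gamma ^+ t * expected_reward t s)).

Lemma expected_rewardS t s : expected_reward t.+1 s =
  \sum_a pi s a * \sum_s' P s a s' * expected_reward t s'.
Proof.
rewrite /expected_reward; apply: eq_bigr => a _; congr (_ * _); rewrite iterS.
pose G z := step (s, a) z * iter t (expected_next step) (fun z => r z.1 z.2) z.
transitivity (\sum_x \sum_b G (x, b)).
  by rewrite pair_bigA; apply: eq_bigr => -[].
apply: eq_bigr => x _; rewrite mulr_sumr; apply: eq_bigr => b _.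
by rewrite /G /step mulrA.
Qed.

Let C : R := \sum_z `|r z.1 z.2|.

Lemma reward_bound s a : `|r s a| <= C.
Proof.
rewrite /C (bigD1 (s, a))//= lerDl; apply: sumr_ge0 => z _; exact: normr_ge0.
Qed.

Lemma expected_reward_bound t s : `|expected_reward t s| <= C.
Proof.
have avg (T : finType) (p g : T -> R) : simplex p -> (forall x, `|g x| <= C) ->
    `|\sum_x p x * g x| <= C.
  move=> [p0 p1] gC; apply: (le_trans (ler_norm_sum _ _ _)).
  rewrite -[leRHS]mul1r -p1 mulr_suml; apply: ler_sum => x _.
  by rewrite normrM (ger0_norm (p0 x)) ler_wpM2l.
elim: t s => [|t IH] s; first by apply: (avg _ _ _ (hpi s)) => a; exact: reward_bound.
rewrite expected_rewardS; apply: (avg _ _ _ (hpi s)) => a.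
exact: (avg _ _ _ (hP s a)).
Qed.

Lemma discounted_partial_sum_bound (u : nat -> R) n : (forall t, `|u t| <= C) ->
  `|series (fun t => gamma ^+ t * u t) n| <= C / (1 - gamma).
Proof.
move=> uC; have /andP[g0 g1] := hgamma.
apply: (@le_trans _ _ (series (geometric C gamma) n)).
  rewrite /series /=; apply: (le_trans (ler_norm_sum _ _ _)); apply: ler_sum => t _.
  by rewrite normrM ger0_norm ?exprn_ge0// mulrC ler_wpM2r ?exprn_ge0.
have C0 : 0 <= C by apply: sumr_ge0 => z _; exact: normr_ge0.
rewrite geometric_seriesE ?lt_eqF//= ler_wpM2r ?invr_ge0 ?subr_ge0 ?(ltW g1)//.
by rewrite ler_piMr// lerBlDr lerDl exprn_ge0.
Qed.

Lemma is_cvg_discounted_series (u : nat -> R) : (forall t, `|u t| <= C) ->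
  cvgn (series (fun t => gamma ^+ t * u t)).
Proof.
move=> uC; have /andP[g0 g1] := hgamma.
apply: normed_cvg; apply: (@series_le_cvg _ _ (geometric C gamma)) => [t|t|t|].
- exact: normr_ge0.
- by rewrite /= mulr_ge0 ?exprn_ge0//; apply: sumr_ge0 => z _; exact: normr_ge0.
- by rewrite /= normrM ger0_norm ?exprn_ge0// mulrC ler_wpM2r ?exprn_ge0.
- by apply: is_cvg_geometric_series; rewrite ger0_norm.
Qed.

(** Partial sums of the return have the expected discounted rewards as integrals and are bounded by
    [C / (1 - gamma)], so dominated convergence applies. The result does not depend on the
    realization, which makes [value] well defined. *)
Lemma controlled_chain_expectation s d (Omega : measurableType d)
    (Pr : probability Omega R) (X : nat -> Omega -> S) (U : nat -> Omega -> A) :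
  controlled_chain pi P s Pr X U ->
  expectation Pr (fun w => discounted_return r gamma (X^~ w) (U^~ w)) =
  (bellman_value s)%:E.
Proof.
move=> [mX mU law]; pose W t w := (X t w, U t w).
pose q (z : S * A) : R := (z.1 == s)%:R * pi z.1 z.2.
have mW t z : measurable [set w | W t w = z].
  rewrite (_ : [set _ | _] = (X t @^-1` [set z.1]) `&` (U t @^-1` [set z.2])).
    exact: measurableI.
  by apply/seteqP; split=> w; rewrite /W; case: z => x a /= [<- <-].
have lawW n (z : nat -> S * A) :
    Pr (cylinder W n z) = (q (z 0%N) * \prod_(t < n) step (z t) (z t.+1))%:E.
  transitivity ((((z 0%N).1 == s)%:R * \prod_(t < n.+1) pi (z t).1 (z t).2 *
         \prod_(t < n) P (z t).1 (z t).2 (z t.+1).1)%:E).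
    rewrite -(law n (fun t => (z t).1) (fun t => (z t).2)); congr (Pr _).
    apply/seteqP; split=> w /= h t tn; first by rewrite -h.
    by rewrite /W; have [-> ->] := h t tn; rewrite -surjective_pairing.
  by rewrite /q /step big_split /= big_ord_recl /=; congr (_%:E); ring.
pose f n w := series (fun t => gamma ^+ t * r (W t w).1 (W t w).2) n.
have mf n : measurable_fun setT (f n).
  apply: measurable_sum => t; apply: measurable_funM => //.
  exact: (measurable_fun_state mW t (fun z => r z.1 z.2)).
have intf n : (\int[Pr]_w (f n w)%:E =
    (series (fun t => gamma ^+ t * expected_reward t s) n)%:E)%E.
  have E t : (\int[Pr]_w (gamma ^+ t * r (W t w).1 (W t w).2)%:E =
     (gamma ^+ t * expected_reward t s)%:E)%E.
    rewrite (integral_state mW lawW (fun z => gamma ^+ t * r z.1 z.2)).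
    congr (_%:E); rewrite /expected_reward.
    (* The discount factor does not depend on the state and passes through the linear transition
       operator. *)
    have lin m : iter m (expected_next step) (fun z => gamma ^+ t * r z.1 z.2) =
        (fun z => gamma ^+ t * iter m (expected_next step) (fun z => r z.1 z.2) z).
      elim: m => //= m ->; apply/funext => z; rewrite /expected_next mulr_sumr.
      by apply: eq_bigr => y _; rewrite mulrCA.
    rewrite lin /q; set h := iter t _ _.
    transitivity (\sum_x \sum_a (x == s)%:R * pi x a * (gamma ^+ t * h (x, a))).
      by rewrite pair_bigA; apply: eq_bigr => -[].
    rewrite (bigD1 s)//= [X in _ + X]big1 ?addr0.
      by rewrite mulr_sumr; apply: eq_bigr => a _; rewrite eqxx mul1r mulrCA.
    by move=> x /negbTE ->; rewrite big1// => a _; rewrite !mul0r.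
  rewrite /f /series/=; under eq_integral do rewrite -sumEFin.
  rewrite integral_sum//.
    by rewrite -sumEFin; apply: eq_bigr => t _; exact: E.
  move=> t; apply: measurable_bounded_integrable => //.
  - by rewrite (le_lt_trans (probability_le1 _ _)) ?ltry.
  - apply: measurable_funM => //.
    exact: (measurable_fun_state mW t (fun z => r z.1 z.2)).
  exists (`|gamma ^+ t| * C); split; first exact: num_real.
  move=> M hM w _ /=; apply: le_trans (ltW hM); rewrite normrM ler_wpM2l//.
  exact: reward_bound.
have cvgf w : f n w @[n --> \oo] --> discounted_return r gamma (X^~ w) (U^~ w).
  by apply: (is_cvg_discounted_series (u := fun t => r (X t w) (U t w))) => t; exact: reward_bound.
rewrite unlock.
have cvgE : (series (fun t => gamma ^+ t * expected_reward t s) n)%:E @[n --> \oo] -->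
    (\int[Pr]_w (discounted_return r gamma (X^~ w) (U^~ w))%:E)%E.
  under eq_fun do rewrite -intf.
  apply: (@dominated_cvg _ _ _ Pr _ measurableT _ _ (cst (C / (1 - gamma))%:E)).
  - by move=> n; apply/measurable_EFinP.
  - by move=> w _; apply: cvg_EFin; [exact: nearW|exact: cvgf].
  - by [].
  - apply: (@measurable_bounded_integrable _ _ _ Pr (cst (C / (1 - gamma)))) => //.
      by rewrite (le_lt_trans (probability_le1 _ _)) ?ltry.
    exists `|C / (1 - gamma)|; split; first exact: num_real.
    by move=> M hM w _ /=; exact: ltW.
  move=> n w _; rewrite lee_fin; apply: discounted_partial_sum_bound => t.
  exact: reward_bound.
apply: (cvg_unique _ cvgE) => //; apply: cvg_EFin; first exact: nearW.
by apply: is_cvg_discounted_series => t; exact: expected_reward_bound.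
Qed.

Lemma valueE s : value r gamma pi P s = bellman_value s.
Proof.
have h : is_value r gamma pi P s (value r gamma pi P s).
  have [d [T [Pr [X [U XU]]]]] := exists_controlled_chain s.
  apply: xgetPex; exists (bellman_value s), d, T, Pr, X, U; split => //.
  exact: controlled_chain_expectation.
move: h => [d [T [Pr [X [U [XU]]]]]].
by rewrite (controlled_chain_expectation XU) => [[]].
Qed.

(** Splitting off the term at time 0 shows that the Bellman operator maps each partial sum to the
    next one; both sides then pass to the limit. *)
Lemma value_fixpoint s : value r gamma pi P s = bellman (value r gamma pi P) s.
Proof.
rewrite valueE; have -> : value r gamma pi P = bellman_value by apply/funext => x; exact: valueE.
pose w n x := series (fun t => gamma ^+ t * expected_reward t x) n.
have wS n x : w n.+1 x = bellman (w n) x.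
  rewrite /w /series /= big_nat_recl//= expr0 mul1r /bellman.
  rewrite [X in X + _](_ : _ = \sum_a pi x a * r x a)//.
  under [RHS]eq_bigr do rewrite mulrDr; rewrite big_split/=; congr (_ + _).
  under eq_bigr do rewrite expected_rewardS.
  rewrite [LHS](_ : _ = \sum_(0 <= i < n) \sum_a pi x a *
      (gamma * \sum_s' P x a s' * (gamma ^+ i * expected_reward i s'))).
    rewrite exchange_big/=; apply: eq_bigr => a _; rewrite -mulr_sumr; congr (_ * _).
    rewrite -mulr_sumr; congr (_ * _); rewrite exchange_big/=; apply: eq_bigr => y _.
    by rewrite -mulr_sumr.
  apply: eq_bigr => i _; rewrite mulr_sumr; apply: eq_bigr => a _.
  rewrite mulrCA; congr (_ * _); rewrite exprS -mulrA; congr (_ * _).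
  by rewrite mulr_sumr; apply: eq_bigr => y _; rewrite mulrCA.
have wl x : w n x @[n --> \oo] --> bellman_value x.
  by apply: is_cvg_discounted_series => t; exact: expected_reward_bound.
have wb : bellman (w n) s @[n --> \oo] --> bellman bellman_value s.
  apply: cvg_fin_sum => a; apply: cvgMl_tmp; apply: cvgD; first exact: cvg_cst.
  by apply: cvgMl_tmp; apply: cvg_fin_sum => y; apply: cvgMl_tmp; exact: wl.
have wb' : bellman (w n) s @[n --> \oo] --> bellman_value s.
  rewrite (_ : (fun n => bellman (w n) s) = [sequence w n.+1 s]_n).
    by rewrite (cvg_shiftS (fun n => w n s)); exact: wl.
  by apply/funext => n; rewrite /= wS.
exact: (cvg_unique _ wb' wb).
Qed.

End Value.

(** * Kullback-Leibler balls *)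

Section KullbackLeibler.
Context {R : realType}.

(* [t |-> p ln (t / q) + p - t] is maximal at [t = p]. *)
Lemma gibbs_kl_term (p q t : R) : 0 <= p -> 0 <= q -> 0 < t ->
  ((p * ln (t / q) + p - t)%:E <= kl_term p q)%E.
Proof.
move=> p0 q0 t0; rewrite /kl_term; case: eqP => [->|/eqP pn0].
  by rewrite mul0r add0r lee_fin add0r oppr_le0 ltW.
case: eqP => [_|/eqP qn0]; first exact: leey.
have pp : 0 < p by rewrite lt_neqAle eq_sym pn0.
have qq : 0 < q by rewrite lt_neqAle eq_sym qn0.
rewrite lee_fin !ln_div ?posrE//.
have h : ln (t / p) <= t / p - 1.
  have := @le_ln1Dx R (t / p - 1); rewrite addrCA subrr addr0; apply.
  by rewrite ltrBrDl subrr divr_gt0.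
rewrite ln_div ?posrE// in h.
have {}h : p * (ln t - ln p) <= t - p.
  apply: (le_trans (ler_wpM2l p0 h)).
  by rewrite mulrBr mulr1 mulrCA divff// mulr1.
lra.
Qed.

Context {T : finType}.

(* By [gibbs_kl_term], the KL ball is an intersection of half-spaces; taking
   t = p + d with d -> 0 avoids the continuity of x ln x at 0. *)
Lemma kl_le_halfspaces (p q : T -> R) (b : R) :
  (forall x, 0 <= p x) -> (forall x, 0 <= q x) ->
  (kl p q <= b%:E)%E <->
  (forall x, q x = 0 -> p x = 0) /\
  (forall t : T -> R, (forall x, 0 < t x) ->
    \sum_x (ln (t x / q x) + 1) * p x <= b + \sum_x t x).
Proof.
move=> p0 q0; split.
  move=> klb; split.
    move=> x qx0; apply/eqP/negP => /negP px0; move: klb.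
    suff -> : kl p q = +oo%E by rewrite leNgt ltry.
    apply/eqP; rewrite -leye_eq /kl (bigD1 x)//= {1}/kl_term (negbTE px0) qx0 eqxx.
    rewrite addye// gt_eqF//.
    (* Gibbs at [t = 1] bounds the remaining terms from below, so the infinite term at [x] is not
       cancelled by [-oo]. *)
    apply: (@lt_le_trans _ _ (\sum_(i | i != x) (p i * ln (1 / q i) + p i - 1)%:E)%E).
      by rewrite sumEFin ltNyr.
    by apply: lee_sum => i _; exact: gibbs_kl_term.
  move=> t t0; rewrite -lerBlDr -lee_fin; apply: le_trans klb.
  rewrite -sumrB -sumEFin; apply: lee_sum => x _.
  by rewrite mulrDl mul1r [ln _ * _]mulrC; exact: gibbs_kl_term.
move=> [ac h]; apply/lee_addgt0Pr => e e0.
(* Shifting every coordinate by [d] adds at most [e] of mass in total; the successor keeps the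
   denominator positive. *)
pose d : R := e / #|T|.+1%:R.
have d0 : 0 < d by rewrite divr_gt0.
have td x : 0 < p x + d by rewrite ltr_wpDl.
have := h _ td.
under eq_bigr do rewrite mulrDl mul1r.
rewrite !big_split/= sumr_const => {}h.
have {}h : \sum_x ln ((p x + d) / q x) * p x <= b + d *+ #|T| by lra.
have de : d *+ #|T| <= e.
  by rewrite -mulr_natr /d mulrAC ler_pdivrMr// (ler_wpM2l (ltW e0))// ler_nat.
rewrite -EFinD; apply: (@le_trans _ _ (\sum_x ln ((p x + d) / q x) * p x)%:E).
  rewrite -sumEFin; apply: lee_sum => x _; rewrite /kl_term.
  case: eqP => [->|/eqP px0]; first by rewrite mulr0.
  case: eqP => [/ac px|/eqP qx0]; first by rewrite px eqxx in px0.
  have pp : 0 < p x by rewrite lt_neqAle eq_sym px0/=.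
  have qq : 0 < q x by rewrite lt_neqAle eq_sym qx0/=.
  rewrite lee_fin mulrC ler_wpM2r// ler_ln ?posrE ?divr_gt0//.
  by rewrite ler_wpM2r ?invr_ge0// lerDl ltW.
by rewrite lee_fin; apply: (le_trans h); rewrite lerD2l.
Qed.

Lemma kl_self (q : T -> R) : kl q q = 0%E.
Proof.
apply: big1 => x _; rewrite /kl_term; case: eqP => // /eqP qx.
by rewrite divff// ln1 mulr0.
Qed.

Definition kl_ball (q : T -> R) (b : R) : set (T -> R) :=
  [set p | simplex p /\ (kl p q <= b%:E)%E].

Lemma continuous_linear_functional (c : T -> R) :
  continuous (fun f : prod_topology (fun _ : T => R) => \sum_x c x * f x).
Proof.
move=> f.
apply: (@cvg_fin_sum R (prod_topology (fun _ : T => R)) T (nbhs f)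
  (fun x g => c x * g x) (fun x => c x * f x)) => x.
apply: (@cvgMl_tmp R _ (nbhs f) _ (fun g => g x) (c x) (f x)).
exact: (@proj_continuous T (fun=> R) x f).
Qed.

(** The ball is cut out of the cube [[0, 1]^T], compact by Tychonoff, by closed conditions on linear
    functionals: total mass, vanishing coordinates and the half-spaces of [kl_le_halfspaces]. *)
Lemma compact_kl_ball (q : T -> R) (b : R) : (forall x, 0 <= q x) ->
  compact (kl_ball q b : set (prod_topology (fun _ : T => R))).
Proof.
move=> q0.
pose L (c : T -> R) (f : prod_topology (fun _ : T => R)) : R := \sum_x c x * f x.
have clL c (D : set R) : closed D -> closed (L c @^-1` D).
  apply: preimage_closed => f _; exact: continuous_linear_functional.
rewrite (_ : kl_ball q b =
  [set f : prod_topology (fun _ : T => R) | forall x, `[0%R, 1%R]%classic (f x)] `&`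
  (L (fun=> 1) @^-1` [set y | y = 1] `&`
  (\bigcap_(x in [set x | q x = 0]) (L (fun y => (y == x)%:R) @^-1` [set y | y = 0]) `&`
   \bigcap_(t in [set t : T -> R | forall x, 0 < t x])
     (L (fun x => ln (t x / q x) + 1) @^-1` [set y | y <= b + \sum_x t x])))).
  apply: compact_closedI.
    exact: (@tychonoff T (fun=> R) (fun=> `[0%R, 1%R]%classic) (fun=> @segment_compact R 0 1)).
  refine (closedI (clL _ _ (@closed_eq R _)) (closedI _ _)).
    by refine (@closed_bigI _ _ _ _ _) => x _; exact: (clL _ _ (@closed_eq R _)).
  by refine (@closed_bigI _ _ _ _ _) => t _; exact: (clL _ _ (@closed_le R _)).
have sum1 (f : T -> R) x : L (fun y => (y == x)%:R) f = f x.
  rewrite /L (bigD1 x)//= eqxx mul1r big1 ?addr0// => y /negbTE ->.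
  by rewrite mul0r.
have sumf (f : T -> R) : L (fun=> 1) f = \sum_x f x by apply: eq_bigr => x _; rewrite mul1r.
apply/seteqP; split=> f /=.
  move=> [[f0 f1] /(kl_le_halfspaces _ f0 q0)[ac hs]]; split.
    move=> x; rewrite in_itv/= f0 -f1 (bigD1 x)//= lerDl.
    exact: sumr_ge0.
  split; first by rewrite sumf.
  by split=> [x /= qx|t t0] /=; [rewrite sum1 ac|exact: hs].
move=> [f01 [f1 [ac hs]]].
have f0 x : 0 <= f x by have := f01 x; rewrite in_itv/= => /andP[].
split; first by split => //; rewrite -sumf.
apply/(kl_le_halfspaces _ f0 q0); split; last by move=> t t0; exact: (hs t).
by move=> x qx; rewrite -sum1; exact: (ac x).
Qed.

Lemma exists_min_kl_ball (q : T -> R) (b : R) (v : T -> R) : simplex q -> 0 <= b ->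
  exists2 p, kl_ball q b p &
    forall p', kl_ball q b p' -> \sum_x p x * v x <= \sum_x p' x * v x.
Proof.
move=> sq b0.
pose f (p : prod_topology (fun _ : T => R)) : R := \sum_x v x * p x.
have [||p /set_mem pB pmin] := @compact_EVT_min _ R f _ _ (@compact_kl_ball q b sq.1).
- by exists q; split => //; rewrite kl_self lee_fin.
- by apply: continuous_subspaceT => p; exact: continuous_linear_functional.
have fE p' : f p' = \sum_x p' x * v x by apply: eq_bigr => x _; rewrite mulrC.
by exists p => // p' /mem_set /pmin; rewrite !fE.
Qed.

(** Where [phat] is positive, [e] is the log-likelihood ratio of [phat] to [q], so the divergence is
    exactly [b]. *)
Lemma exponential_tilt_kl_ball (q phat e : T -> R) (b : R) :
  simplex q -> simplex phat ->
  (forall x, phat x = q x * expR (e x)) -> \sum_x phat x * e x = b ->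
  kl_ball q b phat.
Proof.
move=> sq sp tilt eb; split => //.
rewrite -eb -sumEFin; apply: lee_sum => x _; rewrite /kl_term.
case: eqP => [->|/eqP px]; first by rewrite mul0r.
case: eqP => [qx|/eqP qx]; first by rewrite tilt qx mul0r eqxx in px.
by rewrite {2}tilt mulrAC divff// mul1r expRK.
Qed.

(** Gibbs at [t = phat] bounds the pairing of [p] with [e] by the divergence of [p] from [q], hence
    by [b], the value reached at [phat]. *)
Lemma exponential_tilt_max (q phat e p : T -> R) (b : R) :
  simplex q -> simplex phat ->
  (forall x, phat x = q x * expR (e x)) -> \sum_x phat x * e x = b ->
  kl_ball q b p -> \sum_x p x * e x <= \sum_x phat x * e x.
Proof.
move=> [q0 _] [_ phat1] tilt -> [[p0 p1] klb].
rewrite -lee_fin; apply: le_trans klb.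
(* Both vectors have mass 1, so the correction terms of the Gibbs bound cancel in the sum. *)
have -> : \sum_x p x * e x = \sum_x (p x * e x + p x - phat x).
  by rewrite sumrB big_split/= p1 phat1 addrK.
rewrite -sumEFin; apply: lee_sum => x _.
(* If [q x = 0] then [phat x = 0] and Gibbs does not apply, but the divergence term is then 0 or
   infinite. *)
have [qx|qx] := eqVneq (q x) 0.
  rewrite tilt qx mul0r subr0 /kl_term eqxx; case: eqP => [->|_].
    by rewrite mul0r addr0.
  exact: leey.
have qq : 0 < q x by rewrite lt_neqAle eq_sym qx/=.
have := @gibbs_kl_term (p x) (q x) (phat x) (p0 x) (q0 x).
rewrite tilt mulrAC divff// mul1r expRK; apply.
by rewrite mulr_gt0 ?expR_gt0.
Qed.

End KullbackLeibler.

(** * Robust values *)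

Section Supnorm.
Context {R : realType} {T : finType}.

Lemma ler_supnorm (f : T -> R) x : `|f x| <= supnorm f.
Proof. exact: le_bigmax. Qed.

Lemma supnorm_ge0 (f : T -> R) : 0 <= supnorm f.
Proof. exact: bigmax_ge_id. Qed.

Lemma supnorm_le (f : T -> R) c : 0 <= c -> (forall x, `|f x| <= c) -> supnorm f <= c.
Proof. by move=> c0 fc; apply: bigmax_le. Qed.

End Supnorm.

(** * Comparison principle and existence of a worst-case kernel *)

Section Robust.
Context {R : realType} {S A : finType} (r : S -> A -> R) (gamma : R).
Variable pi : S -> A -> R.
Hypotheses (hgamma : 0 <= gamma < 1) (hpi : policies pi).

Local Notation bellman P := (bellman r gamma pi P).
Local Notation value P := (value r gamma pi P).

Lemma le_bellman_kernel (P P' : S -> A -> S -> R) (w : S -> R) s :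
  (forall a, \sum_s' P s a s' * w s' <= \sum_s' P' s a s' * w s') ->
  bellman P w s <= bellman P' w s.
Proof.
move=> h; have /andP[g0 _] := hgamma; apply: ler_sum => a _.
by rewrite ler_wpM2l ?(hpi s).1// lerD2l ler_wpM2l.
Qed.

Lemma le_bellman_shift P (w w' : S -> R) c s : kernels P ->
  (forall x, w x <= w' x + c) -> bellman P w s <= bellman P w' s + gamma * c.
Proof.
move=> hP h; have /andP[g0 _] := hgamma.
rewrite -[X in _ + X]mul1r -(hpi s).2 mulr_suml -big_split/=; apply: ler_sum => a _.
rewrite -mulrDr ler_wpM2l ?(hpi s).1// -addrA lerD2l -mulrDr ler_wpM2l//.
rewrite -[X in _ + X]mul1r -(hP s a).2 mulr_suml -big_split/=; apply: ler_sum => y _.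
by rewrite -mulrDr ler_wpM2l ?(hP s a).1.
Qed.

Lemma le_bellman P (w w' : S -> R) s : kernels P ->
  (forall x, w x <= w' x) -> bellman P w s <= bellman P w' s.
Proof.
move=> hP h; rewrite -[leRHS]addr0 -(mulr0 gamma); apply: le_bellman_shift => // x.
by rewrite addr0.
Qed.

(** The largest positive excess [c] of [w] over [w'] satisfies [c <= gamma * c] after one
    application of the operator, hence vanishes. *)
Lemma bellman_comparison P (w w' : S -> R) : kernels P ->
  (forall s, w s <= bellman P w s) -> (forall s, bellman P w' s <= w' s) ->
  forall s, w s <= w' s.
Proof.
move=> hP sub super; have /andP[g0 g1] := hgamma.
pose c := \big[Num.max/0]_s (w s - w' s).
have wc s : w s <= w' s + c by rewrite -lerBlDl; exact: le_bigmax.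
have c0 : 0 <= c by exact: bigmax_ge_id.
have cg : c <= gamma * c.
  apply: bigmax_le; first exact: mulr_ge0.
  move=> s _; have := sub s; have := super s; have := le_bellman_shift s hP wc; lra.
have {}c0 : c <= 0 by nra.
by move=> s; apply: (le_trans (wc s)); rewrite gerDl.
Qed.

Lemma value_le P (w : S -> R) : kernels P ->
  (forall s, bellman P w s <= w s) -> forall s, value P s <= w s.
Proof.
move=> hP; apply: bellman_comparison => // s.
by rewrite -value_fixpoint.
Qed.

(** Makes the infimum over the uncertainty set meaningful. The constant [- c] lies below its own
    Bellman image, since rewards are at least [- C]. *)
Lemma value_lower_bound P s : kernels P ->
  - ((\sum_z `|r z.1 z.2|) / (1 - gamma)) <= value P s.
Proof.
move=> hP; have /andP[g0 g1] := hgamma; set C := \sum_z _.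
set c := C / (1 - gamma); have cE : - c = - C + gamma * - c by rewrite /c; field; lra.
move: s; apply: (@bellman_comparison P (fun=> - c)) => //; last first.
  by move=> s; rewrite -value_fixpoint.
move=> s; rewrite -[leLHS]mul1r -(hpi s).2 mulr_suml; apply: ler_sum => a _.
rewrite ler_wpM2l ?(hpi s).1// -mulr_suml (hP s a).2 mul1r [leLHS]cE lerD2r lerNl.
apply: (@le_trans _ _ `|r s a|); first by rewrite -normrN ler_norm.
by rewrite /C (bigD1 (s, a))//= lerDl; apply: sumr_ge0 => z _; exact: normr_ge0.
Qed.

Variables (Pbar : S -> A -> S -> R) (beta : S -> A -> R).
Hypotheses (hPbar : kernels Pbar) (hbeta : forall s a, 0 < beta s a).
Let U := kl_uncertainty Pbar beta.

Lemma kl_uncertainty_ball P : U P <-> forall s a, kl_ball (Pbar s a) (beta s a) (P s a).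
Proof.
split; first by move=> [hP hkl] s a; split; [exact: hP|exact: hkl].
by move=> h; split=> s a; have [] := h s a.
Qed.

Lemma Pbar_kl_uncertainty : U Pbar.
Proof. by split=> // s a; rewrite kl_self lee_fin ltW. Qed.

(* A kernel greedy for [V s = inf_P v_P s] has value at most [V]. *)
Lemma exists_robust_kernel :
  exists2 Pstar, U Pstar & forall P s, U P -> value Pstar s <= value P s.
Proof.
pose V s := inf [set value P s | P in U].
have lbV s : has_lbound [set value P s | P in U].
  by eexists => _ [P [hP _] <-]; exact: value_lower_bound.
have VU P s : U P -> V s <= value P s by move=> UP; apply: ge_inf => //; exists P.
have [Pstar hPstar] : exists Pstar : S -> A -> S -> R, forall s a,
    kl_ball (Pbar s a) (beta s a) (Pstar s a) /\
    forall p, kl_ball (Pbar s a) (beta s a) p ->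
      \sum_x Pstar s a x * V x <= \sum_x p x * V x.
  (* The set is rectangular, so minimizers for distinct pairs can be chosen independently and still
     form an admissible kernel. *)
  have /choice[f hf] (sa : S * A) : exists p, kl_ball (Pbar sa.1 sa.2) (beta sa.1 sa.2) p /\
      forall p', kl_ball (Pbar sa.1 sa.2) (beta sa.1 sa.2) p' ->
      \sum_x p x * V x <= \sum_x p' x * V x.
    have [p pB pmin] := @exists_min_kl_ball R S _ _ V (hPbar sa.1 sa.2) (ltW (hbeta sa.1 sa.2)).
    by exists p.
  by exists (fun s a => f (s, a)) => s a; exact: (hf (s, a)).
have UPstar : U Pstar by apply/kl_uncertainty_ball => s a; exact: (hPstar s a).1.
exists Pstar => // P s UP; apply: (@le_trans _ _ (V s)); last exact: VU.
move: s; apply: value_le; first exact: UPstar.1.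
move=> s; apply: lb_le_inf; first by exists (value Pbar s), Pbar => //; exact: Pbar_kl_uncertainty.
move=> _ [Q UQ <-]; rewrite value_fixpoint//; last exact: UQ.1.
(* Greediness of [Pstar] for [V] replaces the kernel by [Q]; then [V <= value Q] and monotonicity
   reach the fixed point of [Q]. *)
apply: (@le_trans _ _ (bellman Q V s)).
  apply: le_bellman_kernel => a; apply: (hPstar s a).2.
  exact: (kl_uncertainty_ball Q).1.
by apply: le_bellman => [|x]; [exact: UQ.1|exact: VU].
Qed.

(** A minimizing kernel makes the set of least elements nonempty, so [xget] does not return its
    default, and a least element is unique. *)
Lemma robust_valueE Pstar s : U Pstar -> (forall P s, U P -> value Pstar s <= value P s) ->
  robust_value r gamma pi U s = value Pstar s.
Proof.
move=> UPstar opt; rewrite /robust_value /minimum.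
set E := [set _ | _ in _].
have [[P UP <-] lbP] : (E `&` lbound E) (xget 0 (E `&` lbound E)).
  apply: xgetPex; exists (value Pstar s); split; first by exists Pstar.
  by move=> _ [P UP <-]; exact: opt.
by apply/eqP; rewrite eq_le opt// andbT lbP//; exists Pstar.
Qed.

End Robust.

(** * Geometric convergence of the iteration *)

Theorem theorem3p5 (R : realType) (S A : finType)
    (r : S -> A -> R) (gamma : R) (mu : S -> R)
    (Pbar : S -> A -> S -> R) (beta : S -> A -> R) (pi : S -> A -> R)
    (P : nat -> S -> A -> S -> R) (omega kappa : nat -> S -> A -> R)
    (hgamma : 0 <= gamma < 1)
    (hmu : simplex mu)
    (hPbar : kernels Pbar)
    (hbeta : forall s a, 0 < beta s a)
    (hpi : policies pi)
    (hP : forall n, kernels (P n))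
    (hP0 : P 0%N = Pbar)
    (hPS : forall n s a s',
      P n.+1 s a s' =
      Pbar s a s' *
      expR (- ((value r gamma pi (P n) s' - omega n s a) / kappa n s a)))
    (hkappa : forall n s a, 0 < kappa n s a)
    (hsum : forall n s a, \sum_s' P n.+1 s a s' = 1)
    (hkl : forall n s a,
      - (\sum_s' P n.+1 s a s' *
          ((value r gamma pi (P n) s' - omega n s a) / kappa n s a)) =
      beta s a) :
  forall n,
    supnorm (fun s => value r gamma pi (P n) s
                      - robust_value r gamma pi (kl_uncertainty Pbar beta) s)
    <= gamma ^+ n *
       supnorm (fun s => value r gamma pi Pbar s
                      - robust_value r gamma pi (kl_uncertainty Pbar beta) s).
Proof.
have [Pstar UPstar opt] := exists_robust_kernel r hgamma hpi hPbar hbeta.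
have -> : robust_value r gamma pi (kl_uncertainty Pbar beta) = value r gamma pi Pstar.
  by apply/funext => s; apply: robust_valueE.
have /andP[g0 _] := hgamma.
set v := fun n => value r gamma pi (P n).
pose e n s a s' := - ((v n s' - omega n s a) / kappa n s a).
have sum_e n s a : \sum_s' P n.+1 s a s' * e n s a s' = beta s a.
  by rewrite -(hkl n s a) -sumrN; apply: eq_bigr => x _; rewrite mulrN.
have UP n : kl_uncertainty Pbar beta (P n).
  case: n => [|n]; first by rewrite hP0; exact: Pbar_kl_uncertainty.
  by apply/kl_uncertainty_ball => s a;
    exact: (exponential_tilt_kl_ball (hPbar s a) (hP n.+1 s a) (hPS n s a) (sum_e n s a)).
have greedy n Q s a : kl_uncertainty Pbar beta Q ->
    \sum_s' P n.+1 s a s' * v n s' <= \sum_s' Q s a s' * v n s'.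
  move=> UQ; have QB := (kl_uncertainty_ball _ _ _).1 UQ s a.
  (* On vectors of mass 1, pairing with the exponent is a decreasing affine function of pairing with
     [v n], so the maximizer of the former minimizes the latter. *)
  have eE p : simplex p -> \sum_x p x * e n s a x =
      (omega n s a - \sum_x p x * v n x) / kappa n s a.
    move=> [_ p1]; rewrite -[omega n s a]mul1r -p1 mulr_suml -sumrB mulr_suml.
    by apply: eq_bigr => x _; rewrite /e; ring.
  have := exponential_tilt_max (hPbar s a) (hP n.+1 s a) (hPS n s a) (sum_e n s a) QB.
  rewrite eE ?eE; [|exact: hP|exact: QB.1].
  by rewrite ler_pM2r ?invr_gt0// lerD2l lerN2.
have contr n s : v n.+1 s - value r gamma pi Pstar s <=
    gamma * supnorm (fun s => v n s - value r gamma pi Pstar s).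
  (* Since [P n] itself competes in the greedy minimization, [v n] is a supersolution for
     [P n.+1]. *)
  have decr x : v n.+1 x <= v n x.
    move: x; apply: value_le => // s'.
    rewrite [leRHS]/v value_fixpoint//.
    by apply: le_bellman_kernel => // a; apply: greedy; exact: UP.
  rewrite lerBlDl [leLHS]/v value_fixpoint// [X in _ <= X + _]value_fixpoint//; last exact: UPstar.1.
  apply: (@le_trans _ _ (bellman r gamma pi Pstar (v n) s)).
    apply: (@le_trans _ _ (bellman r gamma pi (P n.+1) (v n) s)); first exact: le_bellman.
    by apply: le_bellman_kernel => // a; exact: greedy.
  apply: le_bellman_shift => //; first exact: UPstar.1.
  by move=> x; rewrite -lerBlDl (le_trans (ler_norm _))// (ler_supnorm (fun s => v n s - _)).
elim=> [|n IH]; first by rewrite expr0 mul1r hP0.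
rewrite exprS -mulrA; apply: (le_trans _ (ler_wpM2l g0 IH)).
apply: supnorm_le => [|s]; first by rewrite mulr_ge0 ?supnorm_ge0.
(* Optimality of [Pstar] makes the difference nonnegative, so the one-sided estimate bounds the
   norm. *)
by rewrite ger0_norm ?contr// subr_ge0 opt.
Qed.
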